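(* Let $\mathbb{C}$ be a pointed finitely complete protomodular category. Then $\mathbb{C}$ is action representable and admits normalizers if and only if for each morphism $f:X\to Z$ in $\mathbb{C}$ the functor $$\mathrm{SplExt}_{\mathbb{C}^{\mathbf{2}}}(\Delta(-),(X,Z,f)):\mathbb{C}^{\mathrm{op}}\to\mathbf{Set}$$ is representable.
   Context: A split extension in a pointed category (of $B$ with kernel $X$) is a diagram $X\xrightarrow{\kappa}A\overset{\alpha}{\underset{\beta}{\rightleftarrows}}B$ with $\alpha:A\to B$, $\beta:B\to A$, where $\kappa$ is the kernel of $\alpha$ and $\alpha\beta=1_B$. A morphism of split extensions from $(X,A,B,\kappa,\alpha,\beta)$ to $(X',A',B',\kappa',\alpha',\beta')$ is a triple $u:X\to X'$, $v:A\to A'$, $w:B\to B'$ with $v\kappa=\kappa'u$, $v\beta=\beta'w$, $w\alpha=\alpha'v$. A pointed finitely complete category is protomodular if it satisfies the split short five lemma: for each such morphism, $v$ is an isomorphism whenever $u$ and $w$ are. For a pointed finitely complete protomodular category $\mathbb{D}$ and an object $X$, $\mathrm{SplExt}_{\mathbb{D}}(-,X):\mathbb{D}^{\mathrm{op}}\to\mathbf{Set}$ sends $B$ to the set of isomorphism classes of split extensions of $B$ with kernel $X$ (isomorphisms being those with $u=1_X$, $w=1_B$) and acts on morphisms by pullback. $\mathbb{D}$ is action representable if $\mathrm{SplExt}_{\mathbb{D}}(-,X)$ is representable for each $X$; equivalently, for each $X$ there is a generic split extension with kernel $X$, i.e. a terminal object in the category of split extensions with kernel object $X$ and morphisms with $u=1_X$.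 $\mathbb{C}^{\mathbf{2}}$ is the category of morphisms of $\mathbb{C}$ with objects triples $(X,Z,f)$, $f:X\to Z$, and $\Delta:\mathbb{C}\to\mathbb{C}^{\mathbf{2}}$ is $\Delta(B)=(B,B,1_B)$. Normalizers (in the sense of Bourn and Gray): for a monomorphism $f:X'\to X$, consider data consisting of morphisms $n:X'\to N$, $m:N\to X$ with $mn=f$, an equivalence relation $r_1,r_2:R\to N$ on $N$, and a morphism $\kappa:X'\to R$ such that the square $\langle r_1,r_2\rangle\kappa=\langle 0,1\rangle n$ is a pullback, where $\langle r_1,r_2\rangle:R\to N\times N$ and $\langle 0,1\rangle:N\to N\times N$. A normalizer of $f$ is such data that is universal: for any other such data $(N',m',n',R',r_1',r_2',\kappa')$ there is a unique pair $h:N'\to N$, $v:R'\to R$ with $mh=m'$, $hn'=n$, $v\kappa'=\kappa$ and $\langle r_1,r_2\rangle v=(h\times h)\langle r_1',r_2'\rangle$. $\mathbb{C}$ admits normalizers if each monomorphism has one. *)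

(* Defs.v *)
From Corelib Require Import ssreflect.
From Stdlib Require Import FinFun ProofIrrelevance FunctionalExtensionality
  PropExtensionality.

Set Implicit Arguments.
Unset Strict Implicit.
Unset Printing Implicit Defensive.
Set Bullet Behavior "None".

Declare Scope cat_scope.
Delimit Scope cat_scope with cat.
Local Open Scope cat_scope.

Record category := Category {
  ob :> Type;
  hom : ob -> ob -> Type;
  idm : forall x, hom x x;
  comp : forall x y z, hom y z -> hom x y -> hom x z;
  comp_idl : forall x y (f : hom x y), comp (idm y) f = f;
  comp_idr : forall x y (f : hom x y), comp f (idm x) = f;
  compA : forall x y z t (h : hom z t) (g : hom y z) (f : hom x y),
    comp h (comp g f) = comp (comp h g) f
}.
Arguments hom {c} x y.
Arguments idm {c} x.
Arguments comp {c x y z} g f : rename.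

Notation "g ∘ f" := (comp g f) (at level 40, left associativity) : cat_scope.

Definition is_iso (C : category) (x y : C) (f : hom x y) : Prop :=
  exists g : hom y x, g ∘ f = idm x /\ f ∘ g = idm y.

Definition monic (C : category) (x y : C) (f : hom x y) : Prop :=
  forall (t : C) (a b : hom t x), f ∘ a = f ∘ b -> a = b.

Record functor (C D : category) := Functor {
  fobj :> C -> D;
  fmap : forall x y : C, hom x y -> hom (fobj x) (fobj y);
  fmap_id : forall x, fmap (idm x) = idm (fobj x);
  fmap_comp : forall x y z (g : hom y z) (f : hom x y),
    fmap (g ∘ f) = fmap g ∘ fmap f
}.
Arguments fmap {C D} f {x y} u : rename.

(* [Type] plays the role of the category of sets: nothing bounds the size of
   the classes of split extensions. *)
Record presheaf (C : category) := Presheaf {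
  psh :> C -> Type;
  pmap : forall x y : C, hom x y -> psh y -> psh x;
  pmap_id : forall x (s : psh x), pmap (idm x) s = s;
  pmap_comp : forall x y z (g : hom y z) (f : hom x y) (s : psh z),
    pmap (g ∘ f) s = pmap f (pmap g s)
}.
Arguments pmap {C} p {x y} f s : rename.

Definition presheaf_comp (C D : category) (F : presheaf D) (G : functor C D) :
  presheaf C.
Proof.
refine {| psh := fun x => F (G x);
          pmap := fun x y f s => pmap F (fmap G f) s |}.
- by move=> x s; rewrite fmap_id pmap_id.
- by move=> x y z g f s; rewrite fmap_comp pmap_comp.
Defined.

Definition representable (C : category) (F : presheaf C) : Prop :=
  exists (r : C) (phi : forall x : C, hom x r -> F x),
    (forall (x y : C) (f : hom x y) (g : hom y r),
        phi x (g ∘ f) = pmap F f (phi y g)) /\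
    (forall x : C, Bijective (phi x)).

(* Being pointed and being finitely complete are structures here: the zero
   object and the limits are chosen. *)
Record zero_object (C : category) := ZeroObject {
  zero : C;
  to_zero : forall x : C, hom x zero;
  from_zero : forall x : C, hom zero x;
  to_zero_uniq : forall (x : C) (f g : hom x zero), f = g;
  from_zero_uniq : forall (x : C) (f g : hom zero x), f = g
}.
Arguments to_zero {C} z x : rename.
Arguments from_zero {C} z x : rename.

Definition zero_mor (C : category) (Z : zero_object C) (x y : C) : hom x y :=
  from_zero Z y ∘ to_zero Z x.

Record cone (J C : category) (D : functor J C) := Cone {
  apex : C;
  leg : forall j : J, hom apex (D j);
  leg_nat : forall (i j : J) (u : hom i j), fmap D u ∘ leg i = leg j
}.
Arguments leg {J C D} c j : rename.

Record limit (J C : category) (D : functor J C) := Limit {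
  lim_cone :> cone D;
  lim_lift : forall c : cone D, hom (apex c) (apex lim_cone);
  lim_lift_leg : forall (c : cone D) (j : J),
    leg lim_cone j ∘ lim_lift c = leg c j;
  lim_lift_uniq : forall (c : cone D) (h : hom (apex c) (apex lim_cone)),
    (forall j, leg lim_cone j ∘ h = leg c j) -> h = lim_lift c
}.
Arguments lim_lift {J C D} l c : rename.

Definition finite_category (J : category) : Prop :=
  Finite J /\ forall i j : J, Finite (hom i j).

Definition finitely_complete (C : category) : Type :=
  forall J : category, finite_category J -> forall D : functor J C, limit D.

Definition is_pullback (C : category) (P X Y Z : C)
    (p : hom P X) (q : hom P Y) (f : hom X Z) (g : hom Y Z) : Prop :=
  f ∘ p = g ∘ q /\
  forall (T : C) (a : hom T X) (b : hom T Y), f ∘ a = g ∘ b ->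
    exists! h : hom T P, p ∘ h = a /\ q ∘ h = b.

Definition preorder_category (T : Type) (le : T -> T -> bool)
    (le_refl : forall x, le x x = true)
    (le_trans : forall x y z, le y z = true -> le x y = true -> le x z = true) :
  category.
Proof.
refine {| ob := T; hom := fun x y => le x y = true;
          idm := le_refl; comp := le_trans |}.
- by move=> *; apply: proof_irrelevance.
- by move=> *; apply: proof_irrelevance.
- by move=> *; apply: proof_irrelevance.
Defined.

Lemma finite_eq_true (b : bool) : Finite (b = true).
Proof.
case: b.
- exists (cons eq_refl nil) => h; left; exact: proof_irrelevance.
- by exists nil => h.
Qed.

Definition pair_category : category.
Proof.
refine (@preorder_category bool Bool.eqb _ _); first by case.
by case; case; case.
Defined.

Lemma pair_category_finite : finite_category pair_category.
Proof.
split; last by move=> i j; apply: finite_eq_true.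
by exists (cons true (cons false nil)); case; [left | right; left].
Qed.

Inductive cospan_ob := cospan_left | cospan_right | cospan_mid.

Definition cospan_le (x y : cospan_ob) : bool :=
  match x, y with
  | _, cospan_mid => true
  | cospan_left, cospan_left => true
  | cospan_right, cospan_right => true
  | _, _ => false
  end.

Definition cospan_category : category.
Proof.
refine (@preorder_category cospan_ob cospan_le _ _); first by case.
by case; case; case.
Defined.

Lemma cospan_category_finite : finite_category cospan_category.
Proof.
split; last by move=> i j; apply: finite_eq_true.
exists (cons cospan_left (cons cospan_right (cons cospan_mid nil))).
by case; [left | right; left | right; right; left].
Qed.

Definition pair_diagram (C : category) (X Y : C) : functor pair_category C.
Proof.
pose fo (b : bool) := if b then X else Y.
refine (@Functor pair_category C fo
  (fun x y => match x, y return Bool.eqb x y = true -> hom (fo x) (fo y) with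
              | true, true => fun _ => idm X
              | false, false => fun _ => idm Y
              | true, false => fun e => False_rect _ (Bool.diff_false_true e)
              | false, true => fun e => False_rect _ (Bool.diff_false_true e)
              end) _ _).
- by case.
- by case; case; case=> //= *; rewrite comp_idl.
Defined.

Definition pair_cone (C : category) (X Y T : C) (a : hom T X) (b : hom T Y) :
  cone (pair_diagram X Y).
Proof.
refine (@Cone pair_category C (pair_diagram X Y) T
  (fun j => match j return hom T (pair_diagram X Y j) with
            | true => a | false => b end) _).
by case; case=> //= u; rewrite comp_idl.
Defined.

Definition cospan_diagram (C : category) (X Y Z : C)
    (f : hom X Z) (g : hom Y Z) : functor cospan_category C.
Proof.
pose fo (x : cospan_ob) :=
  match x with cospan_left => X | cospan_right => Y | cospan_mid => Z end.
refine (@Functor cospan_category C fo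
  (fun x y => match x, y return cospan_le x y = true -> hom (fo x) (fo y) with
              | cospan_left, cospan_left => fun _ => idm X
              | cospan_right, cospan_right => fun _ => idm Y
              | cospan_mid, cospan_mid => fun _ => idm Z
              | cospan_left, cospan_mid => fun _ => f
              | cospan_right, cospan_mid => fun _ => g
              | _, _ => fun e => False_rect _ (Bool.diff_false_true e)
              end) _ _).
- by case.
- by case; case; case=> //= *; rewrite ?comp_idl ?comp_idr.
Defined.

Definition cospan_cone (C : category) (X Y Z : C) (f : hom X Z) (g : hom Y Z)
    (T : C) (a : hom T X) (b : hom T Y) (e : f ∘ a = g ∘ b) :
  cone (cospan_diagram f g).
Proof.
refine (@Cone cospan_category C (cospan_diagram f g) T
  (fun j => match j return hom T (cospan_diagram f g j) with
            | cospan_left => a | cospan_right => b | cospan_mid => f ∘ a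
            end) _).
by case; case=> //= u; rewrite ?comp_idl.
Defined.

Section Limits.
Variables (C : category) (L : finitely_complete C).

Section Product.
Variables X Y : C.

Let lim := L pair_category_finite (pair_diagram X Y).

Definition prod_ob : C := apex lim.
Definition prod_fst : hom prod_ob X := leg lim true.
Definition prod_snd : hom prod_ob Y := leg lim false.
Definition prod_pair (T : C) (a : hom T X) (b : hom T Y) : hom T prod_ob :=
  lim_lift lim (pair_cone a b).

Lemma prod_fstK (T : C) (a : hom T X) (b : hom T Y) :
  prod_fst ∘ prod_pair a b = a.
Proof. exact: (lim_lift_leg lim (pair_cone a b) true). Qed.

Lemma prod_sndK (T : C) (a : hom T X) (b : hom T Y) :
  prod_snd ∘ prod_pair a b = b.
Proof. exact: (lim_lift_leg lim (pair_cone a b) false). Qed.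

Lemma prod_ext (T : C) (h k : hom T prod_ob) :
  prod_fst ∘ h = prod_fst ∘ k -> prod_snd ∘ h = prod_snd ∘ k -> h = k.
Proof.
move=> e1 e2.
have U := @lim_lift_uniq _ _ _ lim (pair_cone (prod_fst ∘ k) (prod_snd ∘ k)).
by apply: (eq_trans (U h _) (eq_sym (U k _))); case.
Qed.

End Product.

Definition prod_map (X X' Y Y' : C) (f : hom X X') (g : hom Y Y') :
    hom (prod_ob X Y) (prod_ob X' Y') :=
  prod_pair (f ∘ prod_fst X Y) (g ∘ prod_snd X Y).

Section Pullback.
Variables (X Y Z : C) (f : hom X Z) (g : hom Y Z).

Let lim := L cospan_category_finite (cospan_diagram f g).

Definition pb_ob : C := apex lim.
Definition pb_fst : hom pb_ob X := leg lim cospan_left.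
Definition pb_snd : hom pb_ob Y := leg lim cospan_right.

Lemma pb_sq : f ∘ pb_fst = g ∘ pb_snd.
Proof.
exact: (eq_trans (@leg_nat _ _ _ lim cospan_left cospan_mid eq_refl)
  (eq_sym (@leg_nat _ _ _ lim cospan_right cospan_mid eq_refl))).
Qed.

Definition pb_pair (T : C) (a : hom T X) (b : hom T Y) (e : f ∘ a = g ∘ b) :
  hom T pb_ob := lim_lift lim (cospan_cone e).

Lemma pb_fstK (T : C) (a : hom T X) (b : hom T Y) (e : f ∘ a = g ∘ b) :
  pb_fst ∘ pb_pair e = a.
Proof. exact: (lim_lift_leg lim (cospan_cone e) cospan_left). Qed.

Lemma pb_sndK (T : C) (a : hom T X) (b : hom T Y) (e : f ∘ a = g ∘ b) :
  pb_snd ∘ pb_pair e = b.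
Proof. exact: (lim_lift_leg lim (cospan_cone e) cospan_right). Qed.

Lemma pb_ext (T : C) (h k : hom T pb_ob) :
  pb_fst ∘ h = pb_fst ∘ k -> pb_snd ∘ h = pb_snd ∘ k -> h = k.
Proof.
move=> e1 e2.
have e : f ∘ (pb_fst ∘ k) = g ∘ (pb_snd ∘ k) by rewrite !compA pb_sq.
have mid (t : hom T pb_ob) : leg lim cospan_mid ∘ t = f ∘ (pb_fst ∘ t).
  rewrite compA; congr (_ ∘ _).
  by symmetry; apply: (@leg_nat _ _ _ lim cospan_left cospan_mid eq_refl).
have U := @lim_lift_uniq _ _ _ lim (cospan_cone e).
apply: (eq_trans (U h _) (eq_sym (U k _))); case=> //.
by rewrite [LHS]mid e1.
Qed.

Lemma pb_is_pullback : is_pullback pb_fst pb_snd f g.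
Proof.
split; first exact: pb_sq.
move=> T a b e; exists (pb_pair e).
split; first by rewrite pb_fstK pb_sndK.
by move=> h [ha hb]; apply: pb_ext; rewrite ?pb_fstK ?pb_sndK.
Qed.

End Pullback.
End Limits.

Definition is_kernel (C : category) (Z : zero_object C) (X A B : C)
    (k : hom X A) (a : hom A B) : Prop :=
  a ∘ k = zero_mor Z X B /\
  forall (T : C) (t : hom T A), a ∘ t = zero_mor Z T B ->
    exists! s : hom T X, k ∘ s = t.

Record splext (C : category) (Z : zero_object C) (B X : C) := SplExtension {
  se_ob : C;
  se_ker : hom X se_ob;
  se_epi : hom se_ob B;
  se_sec : hom B se_ob;
  se_split : se_epi ∘ se_sec = idm B;
  se_kernel : is_kernel Z se_ker se_epi
}.

Definition is_splext_mor (C : category) (Z : zero_object C) (B X B' X' : C)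
    (e : splext Z B X) (e' : splext Z B' X')
    (u : hom X X') (v : hom (se_ob e) (se_ob e')) (w : hom B B') : Prop :=
  v ∘ se_ker e = se_ker e' ∘ u /\
  v ∘ se_sec e = se_sec e' ∘ w /\
  w ∘ se_epi e = se_epi e' ∘ v.

Definition protomodular (C : category) (Z : zero_object C) : Prop :=
  forall (B X B' X' : C) (e : splext Z B X) (e' : splext Z B' X')
    (u : hom X X') (v : hom (se_ob e) (se_ob e')) (w : hom B B'),
    is_splext_mor u v w -> is_iso u -> is_iso w -> is_iso v.

Definition splext_iso (C : category) (Z : zero_object C) (B X : C)
    (e e' : splext Z B X) : Prop :=
  exists v : hom (se_ob e) (se_ob e'),
    is_splext_mor (idm X) v (idm B) /\ is_iso v.

(* When [R] is an equivalence relation this is the set of its classes. *)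
Definition quotient (T : Type) (R : T -> T -> Prop) : Type :=
  { P : T -> Prop | exists x, P = R x }.

Lemma quotient_eq (T : Type) (R : T -> T -> Prop) (p q : quotient R) :
  (forall x, proj1_sig p x <-> proj1_sig q x) -> p = q.
Proof.
move=> pq; apply: eq_sig_hprop => [*|]; first exact: proof_irrelevance.
apply: functional_extensionality => x.
exact: propositional_extensionality.
Qed.

Section SplExt.
Variables (C : category) (Z : zero_object C).

Lemma zero_mor_compl (x y z : C) (f : hom y z) :
  f ∘ zero_mor Z x y = zero_mor Z x z.
Proof. by rewrite /zero_mor compA; congr (_ ∘ _); apply: from_zero_uniq. Qed.

Lemma zero_mor_compr (x y z : C) (f : hom x y) :
  zero_mor Z y z ∘ f = zero_mor Z x z.
Proof. by rewrite /zero_mor -compA; congr (_ ∘ _); apply: to_zero_uniq. Qed.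

Lemma is_iso_id (x : C) : is_iso (idm x).
Proof. by exists (idm x); rewrite comp_idl. Qed.

Lemma is_iso_comp (x y z : C) (g : hom y z) (f : hom x y) :
  is_iso g -> is_iso f -> is_iso (g ∘ f).
Proof.
move=> [g' [g1 g2]] [f' [f1 f2]]; exists (f' ∘ g'); split.
  by rewrite compA -(compA f') g1 comp_idr.
by rewrite compA -(compA g) f2 comp_idr.
Qed.

Lemma splext_iso_refl (B X : C) (e : splext Z B X) : splext_iso e e.
Proof.
exists (idm _); split; last exact: is_iso_id.
by split; [|split]; rewrite comp_idl comp_idr.
Qed.

Lemma splext_iso_sym (B X : C) (e e' : splext Z B X) :
  splext_iso e e' -> splext_iso e' e.
Proof.
move=> [v [[vk [vs ve]] [v' [v1 v2]]]]; exists v'; split; last by exists v.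
rewrite !comp_idr in vk vs; rewrite comp_idl in ve.
split; [|split]; rewrite ?comp_idr ?comp_idl.
- by rewrite -vk compA v1 comp_idl.
- by rewrite -vs compA v1 comp_idl.
- by rewrite ve -compA v2 comp_idr.
Qed.

Lemma splext_iso_trans (B X : C) (e1 e2 e3 : splext Z B X) :
  splext_iso e1 e2 -> splext_iso e2 e3 -> splext_iso e1 e3.
Proof.
move=> [v [[vk [vs ve]] vi]] [w [[wk [ws we]] wi]]; exists (w ∘ v).
rewrite !comp_idr in vk vs wk ws; rewrite comp_idl in ve; rewrite comp_idl in we.
split; last exact: is_iso_comp.
split; [|split]; rewrite ?comp_idr ?comp_idl.
- by rewrite -compA vk.
- by rewrite -compA vs.
- by rewrite compA -we -ve.
Qed.

Variable L : finitely_complete C.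

Section PullbackSplExt.
Variables (X B B' : C) (f : hom B' B) (e : splext Z B X).

Lemma splext_pb_ker_eq : se_epi e ∘ se_ker e = f ∘ zero_mor Z X B'.
Proof. by rewrite zero_mor_compl; case: (se_kernel e). Qed.

Lemma splext_pb_sec_eq : se_epi e ∘ (se_sec e ∘ f) = f ∘ idm B'.
Proof. by rewrite compA se_split comp_idl comp_idr. Qed.

Lemma splext_pb_kernel :
  is_kernel Z (pb_pair L splext_pb_ker_eq) (pb_snd L (se_epi e) f).
Proof.
split; first by rewrite pb_sndK.
move=> T t t0; have [_ ker] := se_kernel e.
have /ker[s [sE sU]] : se_epi e ∘ (pb_fst L (se_epi e) f ∘ t) = zero_mor Z T B.
  by rewrite compA pb_sq -compA t0 zero_mor_compl.
exists s; split=> [|s' s'E].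
  apply: pb_ext; rewrite compA ?pb_fstK ?pb_sndK //.
  by rewrite t0 zero_mor_compr.
by apply: sU; rewrite -s'E compA pb_fstK.
Qed.

Definition splext_pb : splext Z B' X := {|
  se_ob := pb_ob L (se_epi e) f;
  se_ker := pb_pair L splext_pb_ker_eq;
  se_epi := pb_snd L (se_epi e) f;
  se_sec := pb_pair L splext_pb_sec_eq;
  se_split := pb_sndK L splext_pb_sec_eq;
  se_kernel := splext_pb_kernel
|}.

End PullbackSplExt.

Lemma splext_pb_iso (X B B' : C) (f : hom B' B) (e e' : splext Z B X) :
  splext_iso e e' -> splext_iso (splext_pb f e) (splext_pb f e').
Proof.
have lift (e1 e2 : splext Z B X) (v : hom (se_ob e1) (se_ob e2)) :
    is_splext_mor (idm X) v (idm B) ->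
    se_epi e2 ∘ (v ∘ pb_fst L (se_epi e1) f) = f ∘ pb_snd L (se_epi e1) f.
  by move=> [_ [_ ve]]; rewrite compA -ve comp_idl pb_sq.
move=> [v [vm [v' [v1 v2]]]].
have vm' : @is_splext_mor C Z B X B X e' e (idm X) v' (idm B).
  case: vm => [vk [vs ve]].
  rewrite !comp_idr in vk vs; rewrite comp_idl in ve.
  split; [|split]; rewrite ?comp_idr ?comp_idl.
  - by rewrite -vk compA v1 comp_idl.
  - by rewrite -vs compA v1 comp_idl.
  - by rewrite ve -compA v2 comp_idr.
exists (pb_pair L (lift _ _ _ vm)); split.
  case: vm (lift _ _ _ vm) => [vk [vs ve]] E; split; [|split] => /=.
  - apply: pb_ext; rewrite !comp_idr compA ?pb_fstK ?pb_sndK //.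
    by rewrite -compA pb_fstK vk comp_idr.
  - apply: pb_ext; rewrite comp_idr compA ?pb_fstK ?pb_sndK //.
    by rewrite -compA pb_fstK compA vs comp_idr.
  - by rewrite comp_idl pb_sndK.
exists (pb_pair L (lift _ _ _ vm')); split; apply: pb_ext;
  rewrite compA ?pb_fstK ?pb_sndK ?comp_idr // -compA pb_fstK compA.
- by rewrite v1 comp_idl.
- by rewrite v2 comp_idl.
Qed.

Lemma splext_pb_id (X B : C) (e : splext Z B X) :
  splext_iso (splext_pb (idm B) e) e.
Proof.
have E : se_epi e ∘ idm _ = idm B ∘ se_epi e by rewrite comp_idl comp_idr.
exists (pb_fst L (se_epi e) (idm B)); split.
  by split; [|split] => /=; rewrite ?pb_fstK ?comp_idr ?pb_sq.
exists (pb_pair L E); split; last by rewrite pb_fstK.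
apply: pb_ext; rewrite compA comp_idr ?pb_fstK ?pb_sndK ?comp_idl //.
by rewrite pb_sq comp_idl.
Qed.

Lemma splext_pb_comp (X B B' B'' : C) (g : hom B' B) (f : hom B'' B')
    (e : splext Z B X) :
  splext_iso (splext_pb (g ∘ f) e) (splext_pb f (splext_pb g e)).
Proof.
pose p1 := pb_fst L (se_epi e) (g ∘ f); pose p2 := pb_snd L (se_epi e) (g ∘ f).
pose q1 := pb_fst L (se_epi e) g; pose q2 := pb_snd L (se_epi e) g.
pose r1 := pb_fst L q2 f; pose r2 := pb_snd L q2 f.
have E1 : se_epi e ∘ p1 = g ∘ (f ∘ p2) by rewrite compA pb_sq.
have E2 : q2 ∘ pb_pair L E1 = f ∘ p2 by rewrite pb_sndK.
have E3 : se_epi e ∘ (q1 ∘ r1) = (g ∘ f) ∘ r2.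
  by rewrite compA pb_sq -/q2 -compA pb_sq -/r2 compA.
exists (pb_pair L E2); split.
  split; [|split] => /=.
  - apply: pb_ext; rewrite comp_idr compA ?pb_fstK ?pb_sndK //.
    apply: pb_ext; rewrite compA ?pb_fstK ?pb_sndK //.
    by rewrite -compA pb_sndK zero_mor_compl.
  - apply: pb_ext; rewrite comp_idr compA ?pb_fstK ?pb_sndK //.
    apply: pb_ext; rewrite compA ?pb_fstK ?pb_sndK.
      by rewrite [RHS]compA pb_fstK compA.
    by rewrite [RHS]compA pb_sndK comp_idl -compA pb_sndK comp_idr.
  - by rewrite comp_idl pb_sndK.
exists (pb_pair L E3); split.
  apply: pb_ext; rewrite compA comp_idr ?pb_fstK ?pb_sndK //.
  by rewrite /r1 -compA !pb_fstK.
apply: pb_ext; rewrite compA comp_idr ?pb_fstK ?pb_sndK //.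
apply: pb_ext; rewrite compA ?pb_fstK ?pb_sndK //.
by rewrite -compA pb_sndK -/r2 -pb_sq.
Qed.

(* The class of [e] is sent to the class of the pullback of [e] along [f]. *)
Definition SplExt_map (X B B' : C) (f : hom B' B)
    (p : quotient (@splext_iso C Z B X)) : quotient (@splext_iso C Z B' X).
Proof.
exists (fun e' => exists e, proj1_sig p e /\ splext_iso (splext_pb f e) e').
have [e0 ->] := proj2_sig p; exists (splext_pb f e0).
apply: functional_extensionality => e'.
apply: propositional_extensionality; split.
- by move=> [e [e0e ee']]; apply: splext_iso_trans ee'; apply: splext_pb_iso.
- by exists e0; split=> //; apply: splext_iso_refl.
Defined.

Lemma SplExt_map_id (X B : C) (p : quotient (@splext_iso C Z B X)) :
  SplExt_map (idm B) p = p.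
Proof.
have [e0 pE] := proj2_sig p; apply: quotient_eq => e' /=; rewrite pE; split.
- move=> [e [e0e ee']]; apply: splext_iso_trans e0e _.
  by apply: splext_iso_trans ee'; apply/splext_iso_sym/splext_pb_id.
- by move=> e0e'; exists e'; split=> //; apply: splext_pb_id.
Qed.

Lemma SplExt_map_comp (X B B' B'' : C) (g : hom B' B) (f : hom B'' B')
    (p : quotient (@splext_iso C Z B X)) :
  SplExt_map (g ∘ f) p = SplExt_map f (SplExt_map g p).
Proof.
apply: quotient_eq => e' /=; split.
- move=> [e [pe ee']]; exists (splext_pb g e); split.
    by exists e; split=> //; apply: splext_iso_refl.
  by apply: splext_iso_trans ee'; apply/splext_iso_sym/splext_pb_comp.
- move=> [e1 [[e [pe ee1]] e1e']]; exists e; split=> //.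
  apply: splext_iso_trans e1e'; apply: splext_iso_trans (splext_pb_comp _ _ _) _.
  exact: splext_pb_iso.
Qed.

Definition SplExt (X : C) : presheaf C := {|
  psh := fun B => quotient (@splext_iso C Z B X);
  pmap := fun B' B f => SplExt_map f;
  pmap_id := @SplExt_map_id X;
  pmap_comp := fun B'' B' B g f => SplExt_map_comp g f
|}.

Definition action_representable : Prop :=
  forall X : C, representable (SplExt X).

End SplExt.

Section Normalizer.
Variables (C : category) (Z : zero_object C) (L : finitely_complete C).

Definition is_equivalence_relation (N R : C) (r1 r2 : hom R N) : Prop :=
  monic (prod_pair L r1 r2) /\
  (exists d : hom N R, r1 ∘ d = idm N /\ r2 ∘ d = idm N) /\
  (exists s : hom R R, r1 ∘ s = r2 /\ r2 ∘ s = r1) /\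
  (exists t : hom (pb_ob L r2 r1) R,
      r1 ∘ t = r1 ∘ pb_fst L r2 r1 /\ r2 ∘ t = r2 ∘ pb_snd L r2 r1).

Record normalizing_data (X' X : C) (f : hom X' X) := NormalizingData {
  nd_ob : C;
  nd_n : hom X' nd_ob;
  nd_m : hom nd_ob X;
  nd_fac : nd_m ∘ nd_n = f;
  nd_rel : C;
  nd_r1 : hom nd_rel nd_ob;
  nd_r2 : hom nd_rel nd_ob;
  nd_equiv : is_equivalence_relation nd_r1 nd_r2;
  nd_ker : hom X' nd_rel;
  nd_pullback : is_pullback nd_ker nd_n
    (prod_pair L nd_r1 nd_r2) (prod_pair L (zero_mor Z nd_ob nd_ob) (idm nd_ob))
}.

Definition is_normalizer (X' X : C) (f : hom X' X) (d : normalizing_data f) :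
    Prop :=
  forall d' : normalizing_data f,
  exists! hv : hom (nd_ob d') (nd_ob d) * hom (nd_rel d') (nd_rel d),
    nd_m d ∘ fst hv = nd_m d' /\
    fst hv ∘ nd_n d' = nd_n d /\
    snd hv ∘ nd_ker d' = nd_ker d /\
    prod_pair L (nd_r1 d) (nd_r2 d) ∘ snd hv =
      prod_map L (fst hv) (fst hv) ∘ prod_pair L (nd_r1 d') (nd_r2 d').

Definition admits_normalizers : Prop :=
  forall (X' X : C) (f : hom X' X), monic f ->
    exists d : normalizing_data f, is_normalizer d.

End Normalizer.

Section Arrow.
Variable C : category.

Record arrow_ob := ArrowOb {
  arr_dom : C;
  arr_cod : C;
  arr : hom arr_dom arr_cod
}.

Record arrow_hom (a b : arrow_ob) := ArrowHom {
  ah_dom : hom (arr_dom a) (arr_dom b);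
  ah_cod : hom (arr_cod a) (arr_cod b);
  ah_sq : ah_cod ∘ arr a = arr b ∘ ah_dom
}.

Lemma arrow_hom_eq (a b : arrow_ob) (f g : arrow_hom a b) :
  ah_dom f = ah_dom g -> ah_cod f = ah_cod g -> f = g.
Proof.
case: f g => [f0 f1 fE] [g0 g1 gE] /= e0 e1; subst g0 g1.
by congr ArrowHom; apply: proof_irrelevance.
Qed.

Definition arrow_category : category.
Proof.
unshelve refine {| ob := arrow_ob; hom := arrow_hom;
  idm := fun a => {| ah_dom := idm (arr_dom a); ah_cod := idm (arr_cod a) |};
  comp := fun a b c g f =>
    {| ah_dom := ah_dom g ∘ ah_dom f; ah_cod := ah_cod g ∘ ah_cod f |} |}.
- by rewrite comp_idl comp_idr.
- by rewrite -compA ah_sq compA ah_sq compA.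
- by move=> *; apply: arrow_hom_eq; apply: comp_idl.
- by move=> *; apply: arrow_hom_eq; apply: comp_idr.
- by move=> *; apply: arrow_hom_eq; apply: compA.
Defined.

Definition arrow_diag : functor C arrow_category.
Proof.
unshelve refine (@Functor C arrow_category
  (fun B => {| arr_dom := B; arr_cod := B; arr := idm B |})
  (fun x y f => @ArrowHom (ArrowOb (idm x)) (ArrowOb (idm y)) f f _) _ _).
- by rewrite /= comp_idl comp_idr.
- by move=> x; apply: arrow_hom_eq.
- by move=> *; apply: arrow_hom_eq.
Defined.

Definition arrow_zero (Z : zero_object C) : zero_object arrow_category.
Proof.
pose z := ArrowOb (idm (zero Z)).
unshelve refine (@ZeroObject arrow_category z
  (fun a => @ArrowHom a z (to_zero Z (arr_dom a)) (to_zero Z (arr_cod a)) _)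
  (fun a => @ArrowHom z a (from_zero Z (arr_dom a)) (from_zero Z (arr_cod a)) _)
  _ _).
- exact: to_zero_uniq.
- exact: from_zero_uniq.
- by move=> a f g; apply: arrow_hom_eq; apply: to_zero_uniq.
- by move=> a f g; apply: arrow_hom_eq; apply: from_zero_uniq.
Defined.

Section Limits.
Variables (J : category) (D : functor J arrow_category).

Definition dom_diagram : functor J C.
Proof.
refine (@Functor J C (fun j => arr_dom (D j)) (fun i j u => ah_dom (fmap D u)) _ _).
- by move=> j; rewrite fmap_id.
- by move=> i j k v u; rewrite fmap_comp.
Defined.

Definition cod_diagram : functor J C.
Proof.
refine (@Functor J C (fun j => arr_cod (D j)) (fun i j u => ah_cod (fmap D u)) _ _).
- by move=> j; rewrite fmap_id.
- by move=> i j k v u; rewrite fmap_comp.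
Defined.

Definition dom_cone (c : cone D) : cone dom_diagram.
Proof.
refine (@Cone J C dom_diagram (arr_dom (apex c)) (fun j => ah_dom (leg c j)) _).
by move=> i j u; rewrite -(leg_nat c u).
Defined.

Definition cod_cone (c : cone D) : cone cod_diagram.
Proof.
refine (@Cone J C cod_diagram (arr_cod (apex c)) (fun j => ah_cod (leg c j)) _).
by move=> i j u; rewrite -(leg_nat c u).
Defined.

Definition dom_cod_cone (c : cone dom_diagram) : cone cod_diagram.
Proof.
refine (@Cone J C cod_diagram (apex c) (fun j => arr (D j) ∘ leg c j) _).
by move=> i j u; rewrite compA (ah_sq (fmap D u)) -compA -(leg_nat c u).
Defined.

Variables (L0 : limit dom_diagram) (L1 : limit cod_diagram).

Definition arrow_lim_cone : cone D.
Proof.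
pose l := ArrowOb (lim_lift L1 (dom_cod_cone L0)).
unshelve refine (@Cone J arrow_category D l
  (fun j => @ArrowHom l (D j) (leg L0 j) (leg L1 j) _) _).
- exact: (lim_lift_leg L1 (dom_cod_cone L0)).
- by move=> i j u; apply: arrow_hom_eq; [apply: (leg_nat L0 u) | apply: (leg_nat L1 u)].
Defined.

Lemma arrow_lift_sq (c : cone D) :
  lim_lift L1 (cod_cone c) ∘ arr (apex c) =
  lim_lift L1 (dom_cod_cone L0) ∘ lim_lift L0 (dom_cone c).
Proof.
have sqE j : leg L1 j ∘ (lim_lift L1 (dom_cod_cone L0) ∘ lim_lift L0 (dom_cone c))
           = arr (D j) ∘ ah_dom (leg c j).
  rewrite compA (lim_lift_leg L1 (dom_cod_cone L0)) /= -compA.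
  by rewrite (lim_lift_leg L0 (dom_cone c)).
have U := @lim_lift_uniq _ _ _ L1 (dom_cod_cone (dom_cone c)).
apply: (eq_trans (U (lim_lift L1 (cod_cone c) ∘ arr (apex c)) _)
          (eq_sym (U _ sqE))) => j.
rewrite compA (lim_lift_leg L1 (cod_cone c)) /=.
exact: (ah_sq (leg c j)).
Qed.

Definition arrow_limit : limit D.
Proof.
refine (@Limit J arrow_category D arrow_lim_cone
  (fun c => @ArrowHom (apex c) (apex arrow_lim_cone) _ _ (arrow_lift_sq c)) _ _).
- move=> c j; apply: arrow_hom_eq.
  + exact: (lim_lift_leg L0 (dom_cone c) j).
  + exact: (lim_lift_leg L1 (cod_cone c) j).
- move=> c h hE; apply: arrow_hom_eq.
  + apply: (@lim_lift_uniq _ _ _ L0 (dom_cone c)) => j /=.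
    by rewrite -(hE j).
  + apply: (@lim_lift_uniq _ _ _ L1 (cod_cone c)) => j /=.
    by rewrite -(hE j).
Defined.

End Limits.

Definition arrow_finitely_complete (L : finitely_complete C) :
    finitely_complete arrow_category :=
  fun J finJ D => arrow_limit (L J finJ (dom_diagram D)) (L J finJ (cod_diagram D)).

End Arrow.

(* Main.v *)
From Corelib Require Import ssreflect.
From Stdlib Require Import ProofIrrelevance FunctionalExtensionality
  PropExtensionality ClassicalEpsilon.
Require Import Defs.

(** In a protomodular category the kernel and the section of a split extension
    generate its middle object ([splext_generated]).  Hence a morphism of split
    extensions is determined by what it does to the kernel and to the base
    ([splext_mor_uniq]), and one that is the identity on kernels exhibits its
    domain as a pullback of its codomain ([mor_over_idP], [mor_over_lift]).  So
    only the relation [mor_over u w e e'], that some morphism lies over [u] and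
    [w], has to be handled.  A representation of [SplExt(-, X)] is then the
    same thing as a generic split extension with kernel [X], which every other
    one maps to over a unique map of bases; and a representation for the arrow
    [f : X -> Z] is a universal pair of split extensions over one base, with
    kernels [X] and [Z], such that some morphism from the first to the second
    lies over [f] and the identity of the base.

    From normalizers to generic pairs ([normalizers_generic_arrow]).  Let [QX]
    and [QZ] be generic split extensions, over bases [rX] and [rZ].  In groups
    the object wanted is the subgroup of the pairs in [rX * rZ] for which [f] is
    equivariant, that is, those that stabilize the graph of [f].  It is
    therefore the preimage, under the section [rX * rZ -> QX * QZ], of the
    normalizer of the graph [X -> X * Z -> QX * QZ].  To classify a pair with
    first member [X -> A -> B] one uses that [X] is normal in [A], so that
    [A -> QX * QZ] factors through the normalizer ([normalizer_universal]).

    From generic pairs to normalizers.  A generic pair for [X -> 0] contains a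
    generic split extension with kernel [X] ([zero_arrow_generic]).  For a
    monomorphism [f : X' -> X], let [D] be the base of the generic pair of [f].
    Both [D] and, by conjugation, [X] map to [rX], and the pullback [N] of
    these two maps is the largest part of [X] whose conjugation action on [X]
    restricts to [X'] ([normalizer_action]).  It is a subobject of [X] because
    a sub-split-extension is determined by its kernel and base
    ([subextension_uniq]), and it carries a reflexive relation whose zero class
    is [X'].  In a protomodular category such a relation is an equivalence
    relation ([reflexive_relation_equivalence]), and [N] is the normalizer
    ([generic_normalizer]). *)

Set Implicit Arguments.
Unset Strict Implicit.
Unset Printing Implicit Defensive.
Set Bullet Behavior "None".

Local Open Scope cat_scope.

(** * Preliminaries *)

(** Rewrites with an equation between composites inside a right-associated
    composite. *)
Lemma compE (C : category) (x y z t : C) (f : hom y z) (g : hom x y)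
    (h : hom x z) (k : hom t x) :
  f ∘ g = h -> f ∘ (g ∘ k) = h ∘ k.
Proof. by move=> <-; rewrite compA. Qed.

Definition factors_through (C : category) (x y z : C) (m : hom y z)
    (f : hom x z) : Prop := exists h : hom x y, m ∘ h = f.

Lemma pb_snd_monic (C : category) (L : finitely_complete C) (X Y Z : C)
    (m : hom X Z) (g : hom Y Z) : monic m -> monic (pb_snd L m g).
Proof.
move=> mm T a b ab; apply: pb_ext => //; apply: mm.
by rewrite !compA pb_sq -!compA ab.
Qed.

(** * Split extensions in a protomodular category *)

Section SplitExtensions.
Variables (C : category) (Z0 : zero_object C) (L : finitely_complete C).

Lemma kernel_zero (X A B : C) (k : hom X A) (a : hom A B) :
  is_kernel Z0 k a -> a ∘ k = zero_mor Z0 X B.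
Proof. by case. Qed.

Lemma kernel_monic (X A B : C) (k : hom X A) (a : hom A B) :
  is_kernel Z0 k a -> monic k.
Proof.
move=> [k0 ker] T x y xy.
have /ker[s [_ sU]] : a ∘ (k ∘ x) = zero_mor Z0 T B.
  by rewrite compA k0 zero_mor_compr.
by rewrite -(sU x) // -(sU y).
Qed.

Definition mor_over (B X B' X' : C) (u : hom X X') (w : hom B B')
    (e : splext Z0 B X) (e' : splext Z0 B' X') : Prop :=
  exists v : hom (se_ob e) (se_ob e'), is_splext_mor u v w.

Lemma mor_over_comp (B X B' X' B'' X'' : C) (u : hom X X') (w : hom B B')
    (u' : hom X' X'') (w' : hom B' B'') (e : splext Z0 B X)
    (e' : splext Z0 B' X') (e'' : splext Z0 B'' X'') :
  mor_over u' w' e' e'' -> mor_over u w e e' ->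
  mor_over (u' ∘ u) (w' ∘ w) e e''.
Proof.
move=> [v' [k' [s' p']]] [v [k [s p]]]; exists (v' ∘ v).
split; [|split].
- by rewrite -compA k !compA k'.
- by rewrite -compA s !compA s'.
- by rewrite -compA p !compA p'.
Qed.

Lemma mor_over_pb (B X B' : C) (w : hom B' B) (e : splext Z0 B X) :
  mor_over (idm X) w (splext_pb L w e) e.
Proof.
exists (pb_fst L (se_epi e) w).
by split; [|split] => /=; rewrite ?pb_fstK ?comp_idr ?pb_sq.
Qed.

Hypothesis proto : protomodular Z0.

(** Through such a [j], [M] is itself a split extension of [B] with kernel [X],
    and [j] is a morphism to [e] over two identities: this is the split short
    five lemma. *)
Lemma splext_generated (B X M : C) (e : splext Z0 B X) (j : hom M (se_ob e)) :
  monic j -> factors_through j (se_ker e) -> factors_through j (se_sec e) ->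
  is_iso j.
Proof.
move=> jm [k kE] [s sE].
have split : (se_epi e ∘ j) ∘ s = idm B by rewrite -compA sE se_split.
have ker : is_kernel Z0 k (se_epi e ∘ j).
  have [e0 eU] := se_kernel e.
  split; first by rewrite -compA kE.
  move=> T t; rewrite -compA => /eU[x [xE xU]]; exists x; split.
    by apply: jm; rewrite compA kE.
  by move=> x' x'E; apply: xU; rewrite -kE -compA x'E.
apply: (proto (e := SplExtension split ker) (e' := e) (u := idm X)
  (w := idm B)); [|exact: is_iso_id|exact: is_iso_id].
by split; [|split]; rewrite /= ?comp_idr ?comp_idl.
Qed.

(** The way generation is used: to land in a subobject it is enough that the
    kernel and the section do.  Apply [splext_generated] to the inverse image
    of [m] along [g]. *)
Lemma splext_factor (B X M Y : C) (e : splext Z0 B X) (m : hom M Y)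
    (g : hom (se_ob e) Y) :
  monic m -> factors_through m (g ∘ se_ker e) ->
  factors_through m (g ∘ se_sec e) -> factors_through m g.
Proof.
move=> mm [k kE] [s sE].
have [j [_ j2]] : is_iso (pb_snd L m g).
  apply: splext_generated; first exact: pb_snd_monic.
  - by exists (pb_pair L kE); rewrite pb_sndK.
  - by exists (pb_pair L sE); rewrite pb_sndK.
by exists (pb_fst L m g ∘ j); rewrite compA pb_sq -compA j2 comp_idr.
Qed.

(** The pair [g], [h] factors through the diagonal of [Y] as soon as it does on
    the kernel and on the section. *)
Lemma splext_jointly_epic (B X Y : C) (e : splext Z0 B X)
    (g h : hom (se_ob e) Y) :
  g ∘ se_ker e = h ∘ se_ker e -> g ∘ se_sec e = h ∘ se_sec e -> g = h.
Proof.
move=> gk gs; pose diag := prod_pair L (idm Y) (idm Y).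
have dm : monic diag.
  move=> T a b /(f_equal (fun x => prod_fst L Y Y ∘ x)).
  by rewrite !compA prod_fstK !comp_idl.
have fact T (t : hom T (se_ob e)) : g ∘ t = h ∘ t ->
    factors_through diag (prod_pair L g h ∘ t).
  move=> gt; exists (g ∘ t); apply: prod_ext.
    by rewrite !compA !prod_fstK comp_idl.
  by rewrite !compA !prod_sndK comp_idl.
have [q qE] := splext_factor dm (fact _ _ gk) (fact _ _ gs).
move: (f_equal (fun x => prod_fst L Y Y ∘ x) qE)
      (f_equal (fun x => prod_snd L Y Y ∘ x) qE).
by rewrite !compA !prod_fstK !prod_sndK => <- <-.
Qed.

(** The third equation of a morphism of split extensions follows from the other
    two, since kernel and section are jointly epic. *)
Lemma splext_morP (B X B' X' : C) (e : splext Z0 B X) (e' : splext Z0 B' X')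
    (u : hom X X') (v : hom (se_ob e) (se_ob e')) (w : hom B B') :
  v ∘ se_ker e = se_ker e' ∘ u -> v ∘ se_sec e = se_sec e' ∘ w ->
  is_splext_mor u v w.
Proof.
move=> vk vs; split; [|split] => //; apply: splext_jointly_epic.
- rewrite -!compA vk (kernel_zero (se_kernel e)).
  by rewrite (compE _ (kernel_zero (se_kernel e'))) zero_mor_compl zero_mor_compr.
- by rewrite -!compA vs se_split (compE _ (se_split e')) comp_idl comp_idr.
Qed.

Lemma splext_mor_uniq (B X B' X' : C) (e : splext Z0 B X)
    (e' : splext Z0 B' X') (u : hom X X') (v v' : hom (se_ob e) (se_ob e'))
    (w : hom B B') :
  is_splext_mor u v w -> is_splext_mor u v' w -> v = v'.
Proof.
by move=> [k [s _]] [k' [s' _]]; apply: splext_jointly_epic; congruence.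
Qed.

(** The first projection of the kernel pair of [v] is split by the diagonal, and
    its kernel, which is the kernel of [v], is zero.  So the kernel pair is
    generated by the diagonal, on which its two projections agree. *)
Lemma splext_mor_monic (B X B' X' : C) (e : splext Z0 B X)
    (e' : splext Z0 B' X') (u : hom X X') (v : hom (se_ob e) (se_ob e'))
    (w : hom B B') :
  is_splext_mor u v w -> monic u -> monic w -> monic v.
Proof.
move=> [vk [vs ve]] um wm.
have diagE : v ∘ idm (se_ob e) = v ∘ idm (se_ob e) by [].
pose p1 := pb_fst L v v; pose p2 := pb_snd L v v.
have split : p1 ∘ pb_pair L diagE = idm _ by rewrite pb_fstK.
have ker : is_kernel Z0 (from_zero Z0 (pb_ob L v v)) p1.
  split; first exact: from_zero_uniq.
  move=> T t t0; exists (to_zero Z0 T).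
  split=> [|s _]; last exact: to_zero_uniq.
  have vt : v ∘ (p2 ∘ t) = zero_mor Z0 T _.
    by rewrite compA -pb_sq -compA t0 zero_mor_compl.
  have [_ eU] := se_kernel e.
  have /eU[s [sE _]] : se_epi e ∘ (p2 ∘ t) = zero_mor Z0 T B.
    by apply: wm; rewrite compA ve -compA vt !zero_mor_compl.
  have s0 : s = zero_mor Z0 T X.
    apply: um; apply: (kernel_monic (se_kernel e')).
    by rewrite compA -vk -compA sE vt !zero_mor_compl.
  apply: pb_ext; rewrite -/p1 -/p2 -/(zero_mor Z0 _ _) zero_mor_compl.
    by rewrite t0.
  by rewrite -sE s0 zero_mor_compl.
have pE : p1 = p2.
  apply: (@splext_jointly_epic _ _ _ (SplExtension split ker)) => /=.
    exact: from_zero_uniq.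
  by rewrite split pb_sndK.
move=> T a b ab; rewrite -(pb_fstK L ab) -[RHS](pb_sndK L ab).
by rewrite -/p1 pE.
Qed.

(** The comparison with the pullback is the identity on kernel and base, hence
    invertible. *)
Lemma mor_over_idP (B X B' : C) (w : hom B B') (e : splext Z0 B X)
    (e' : splext Z0 B' X) :
  mor_over (idm X) w e e' <-> splext_iso (splext_pb L w e') e.
Proof.
split=> [[v [vk [vs ve]]] | /splext_iso_sym[v [vm _]]].
- apply: splext_iso_sym.
  have E : se_epi e' ∘ v = w ∘ se_epi e by [].
  have m : @is_splext_mor _ _ _ _ _ _ e (splext_pb L w e') (idm X)
      (pb_pair L E) (idm B).
    apply: splext_morP; rewrite comp_idr; apply: pb_ext;
      rewrite /= compA ?pb_fstK ?pb_sndK //.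
    + by rewrite vk comp_idr.
    + exact: (kernel_zero (se_kernel e)).
    + exact: se_split.
  exists (pb_pair L E); split=> //.
  by apply: (proto m); exact: is_iso_id.
- rewrite -(comp_idl (idm X)) -(comp_idr w).
  by apply: mor_over_comp (mor_over_pb w e') _; exists v.
Qed.

(** Morphisms that are the identity on kernels are cartesian over their map of
    bases. *)
Lemma mor_over_lift (B X B' X' B'' : C) (u : hom X X') (w' : hom B B')
    (w : hom B' B'') (e : splext Z0 B X) (e' : splext Z0 B' X')
    (e'' : splext Z0 B'' X') :
  mor_over (idm X') w e' e'' -> mor_over u (w ∘ w') e e'' ->
  mor_over u w' e e'.
Proof.
move=> /mor_over_idP[j [jm _]] [v [vk [vs ve]]].
have E : se_epi e'' ∘ v = w ∘ (w' ∘ se_epi e) by rewrite -ve compA.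
rewrite -(comp_idl u) -(comp_idl w').
apply: (mor_over_comp (e' := splext_pb L w e'')); first by exists j.
exists (pb_pair L E); apply: splext_morP; apply: pb_ext;
  rewrite /= !compA ?pb_fstK ?pb_sndK //.
- by rewrite -compA (kernel_zero (se_kernel e)) zero_mor_compr zero_mor_compl.
- by rewrite vs compA.
- by rewrite -compA se_split comp_idr comp_idl.
Qed.

(** Both [e1] and [e2] are subobjects of [e]; as [e1] is generated by its kernel
    and section, which lie in [e2], it is contained in [e2]. *)
Lemma subextension_uniq (B X X' : C) (u : hom X X') (e1 e2 : splext Z0 B X)
    (e : splext Z0 B X') :
  monic u -> mor_over u (idm B) e1 e -> mor_over u (idm B) e2 e ->
  mor_over (idm X) (idm B) e1 e2.
Proof.
move=> um [v1 m1] [v2 m2].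
have v2m : monic v2.
  by apply: (splext_mor_monic m2) => // T a b; rewrite !comp_idl.
case: m1 m2 => [k1 [s1 _]] [k2 [s2 _]].
have [] := @splext_factor _ _ _ _ e1 v2 v1 v2m.
- by exists (se_ker e2); rewrite k1 k2.
- by exists (se_sec e2); rewrite s1 s2.
move=> v vE; exists v; apply: splext_morP; apply: v2m;
  rewrite comp_idr compA vE; congruence.
Qed.

(** Protomodular categories are Mal'tsev.  A reflexive relation [x R y] is a
    split extension of [N] by its first projection.  It suffices to prove that
    [x R y] and [x R z] imply [z R y].  The triples with [x R y] and [x R z]
    form a split extension of [R] by the projection [(x, y, z) |-> (x, z)], with
    section [(x, z) |-> (x, z, z)] and kernel the triples [(0, y, 0)]; on both
    of these [z R y] holds, so it holds everywhere. *)
Lemma reflexive_relation_equivalence (N X : C) (e : splext Z0 N X)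
    (r : hom (se_ob e) N) :
  monic (prod_pair L (se_epi e) r) -> r ∘ se_sec e = idm N ->
  is_equivalence_relation L (se_epi e) r.
Proof.
move=> rm rs; pose q := se_epi e; pose s := se_sec e.
have qs : q ∘ s = idm N := se_split e.
have euclid (T : C) (a b : hom T (se_ob e)) : q ∘ a = q ∘ b ->
    exists c, q ∘ c = r ∘ a /\ r ∘ c = r ∘ b.
  (* [p1] and [p2] send [(x, y, z)] to [(x, y)] and [(x, z)]; [g] sends it to
     [(z, y)]. *)
  move=> ab; pose p1 := pb_fst L q q; pose p2 := pb_snd L q q.
  have diagE : q ∘ idm _ = q ∘ idm _ by [].
  have split : p2 ∘ pb_pair L diagE = idm _ by rewrite pb_sndK.
  pose g := prod_pair L (r ∘ p2) (r ∘ p1).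
  have rk : factors_through (prod_pair L q r)
      (g ∘ pb_pair L (splext_pb_ker_eq q e)).
    exists (se_ker e); apply: prod_ext.
      rewrite /g !compA !prod_fstK -compA pb_sndK zero_mor_compl.
      exact: (kernel_zero (se_kernel e)).
    by rewrite /g !compA !prod_sndK -compA pb_fstK.
  have rd : factors_through (prod_pair L q r) (g ∘ pb_pair L diagE).
    exists (s ∘ r); apply: prod_ext.
      by rewrite /g !compA !prod_fstK qs comp_idl -compA pb_sndK comp_idr.
    by rewrite /g !compA !prod_sndK rs comp_idl -compA pb_fstK comp_idr.
  have [c cE] := @splext_factor _ _ _ _
    (SplExtension split (splext_pb_kernel L q e)) _ g rm rk rd.
  exists (c ∘ pb_pair L (eq_sym ab)); rewrite !compA.
  move: (f_equal (fun x => prod_fst L N N ∘ x) cE)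
        (f_equal (fun x => prod_snd L N N ∘ x) cE).
  rewrite /g !compA !prod_fstK !prod_sndK => -> ->.
  by rewrite -!compA pb_fstK pb_sndK.
(* Symmetry is the case [x R y], [x R x]; transitivity of [x R y], [y R z]
   comes from [y R x], [y R z]. *)
have qsr : q ∘ idm _ = q ∘ (s ∘ q) by rewrite compA qs comp_idl comp_idr.
have [sym [sym1 sym2]] := euclid _ _ _ qsr.
rewrite comp_idr in sym1; rewrite compA rs comp_idl in sym2.
split=> //; split; [|split].
- by exists s.
- by exists sym.
- have E : q ∘ (sym ∘ pb_fst L r q) = q ∘ pb_snd L r q.
    by rewrite compA sym1 pb_sq.
  have [t [t1 t2]] := euclid _ _ _ E.
  by exists t; rewrite t1 t2 compA sym2.
Qed.

End SplitExtensions.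

(** * Representations are generic split extensions *)

Section Representability.
Variables (C D : category) (Z0 : zero_object D) (L : finitely_complete D).
Hypothesis proto : protomodular Z0.
Variable G : functor C D.

Definition generic_along (X : D) (r : C) (g : splext Z0 (G r) X) : Prop :=
  forall (B : C) (e : splext Z0 (G B) X),
    exists! w : hom B r, mor_over (idm X) (fmap G w) e g.

Lemma SplExt_class_map (X B B' : D) (w : hom B' B) (e : splext Z0 B X)
    (p : SplExt Z0 L X B) :
  proj1_sig p = @splext_iso D Z0 B X e ->
  proj1_sig (pmap (SplExt Z0 L X) w p) =
    @splext_iso D Z0 B' X (splext_pb L w e).
Proof.
move=> pE; apply: functional_extensionality => e'.
apply: propositional_extensionality; rewrite /= pE.
split=> [[e1 [ee1 e1e']] | ee'].
  by apply: splext_iso_trans e1e'; apply: splext_pb_iso.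
by exists e; split=> //; apply: splext_iso_refl.
Qed.

(** Yoneda: a representation is determined by the class of [g], and [w] is sent
    to the class of the pullback of [g] along [w], which is the class of [e]
    exactly when some morphism from [e] to [g] lies over [w]. *)
Lemma representable_generic (X : D) :
  representable (presheaf_comp (SplExt Z0 L X) G) <->
  exists (r : C) (g : splext Z0 (G r) X), generic_along g.
Proof.
split=> [[r [phi [phi_nat phi_bij]]] | [r [g gen]]].
- have [g gE] := proj2_sig (phi r (idm r)).
  have phiE B (w : hom B r) :
      proj1_sig (phi B w) = @splext_iso _ _ _ _ (splext_pb L (fmap G w) g).
    rewrite -{1}(comp_idl w) phi_nat; exact: SplExt_class_map.
  exists r, g => B e; have [psi [phiK psiK]] := phi_bij B.
  pose p : SplExt Z0 L X (G B) := exist _ _ (ex_intro _ e eq_refl).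
  exists (psi p); split.
    apply/(mor_over_idP L proto); rewrite -phiE psiK /=.
    exact: splext_iso_refl.
  move=> w /(mor_over_idP L proto) we; rewrite -(phiK w); congr (psi _).
  apply: quotient_eq => e'; rewrite phiE /=; split.
  + by apply: splext_iso_trans.
  + by apply: splext_iso_trans; apply: splext_iso_sym.
- pose p0 : SplExt Z0 L X (G r) := exist _ _ (ex_intro _ g eq_refl).
  have p0E : proj1_sig p0 = @splext_iso _ _ _ _ g by [].
  exists r, (fun B w => pmap (SplExt Z0 L X) (fmap G w) p0); split.
    by move=> B B' f w; rewrite fmap_comp pmap_comp.
  move=> B.
  have ex (p : SplExt Z0 L X (G B)) :
      exists w : hom B r, pmap (SplExt Z0 L X) (fmap G w) p0 = p.
    have [e pE] := proj2_sig p; have [w [we _]] := gen B e.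
    exists w; apply: quotient_eq => e'.
    rewrite (SplExt_class_map _ p0E) pE.
    move/(mor_over_idP L proto) : we => we; split.
    + by apply: splext_iso_trans; apply: splext_iso_sym.
    + by apply: splext_iso_trans.
  have choose p := constructive_indefinite_description _ (ex p).
  exists (fun p => proj1_sig (choose p)); split; last first.
    by move=> p; case: (choose p).
  move=> w; case: (choose _) => w' /= w'E.
  have [w0 [_ w0U]] := gen B (splext_pb L (fmap G w) g).
  rewrite -(w0U w (mor_over_pb L _ _)); symmetry; apply: w0U.
  apply/(mor_over_idP L proto).
  have := f_equal (@proj1_sig _ _) w'E.
  rewrite !(SplExt_class_map _ p0E) => ->.
  exact: splext_iso_refl.
Qed.

End Representability.

(** * Split extensions in the category of arrows *)

Section ArrowSplitExtensions.
Variables (C : category) (Z0 : zero_object C).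

Notation arrow := (arrow_category C).
Notation AZ := (arrow_zero Z0).

Lemma is_iso_arrowP (a b : arrow) (h : hom a b) :
  is_iso h <-> is_iso (ah_dom h) /\ is_iso (ah_cod h).
Proof.
split=> [[g [gh hg]] | [[g0 [gh0 hg0]] [g1 [gh1 hg1]]]].
  split; [exists (ah_dom g) | exists (ah_cod g)].
    by split; [rewrite -[LHS]/(ah_dom (g ∘ h)) gh | rewrite -[LHS]/(ah_dom (h ∘ g)) hg].
  by split; [rewrite -[LHS]/(ah_cod (g ∘ h)) gh | rewrite -[LHS]/(ah_cod (h ∘ g)) hg].
have sq : g1 ∘ arr b = arr a ∘ g0.
  rewrite -(comp_idr (arr b)) -hg0 (compA (arr b)) -(ah_sq h) !compA gh1.
  by rewrite comp_idl.
exists (ArrowHom sq).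
by split; apply: arrow_hom_eq.
Qed.

(** Morphisms from [T] to the domain of an arrow [a] correspond to morphisms
    from the identity arrow of [T] to [a]. *)
Lemma arrow_kernel_dom (x a b : arrow) (k : hom x a) (p : hom a b) :
  is_kernel AZ k p -> is_kernel Z0 (ah_dom k) (ah_dom p).
Proof.
move=> [k0 ker]; split.
  exact: (f_equal (@ah_dom _ _ _) k0).
move=> T t t0.
pose t' : @hom arrow (ArrowOb (idm T)) a :=
  @ArrowHom _ (ArrowOb (idm T)) a t (arr a ∘ t) (comp_idr _).
have /ker[s [sE sU]] : p ∘ t' = zero_mor AZ _ _.
  apply: arrow_hom_eq => //=.
  rewrite compA (ah_sq p) -compA t0 zero_mor_compl //.
exists (ah_dom s); split; first exact: (f_equal (@ah_dom _ _ _) sE).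
move=> s' s'E.
pose s1 : @hom arrow (ArrowOb (idm T)) x :=
  @ArrowHom _ (ArrowOb (idm T)) x s' (arr x ∘ s') (comp_idr _).
rewrite (sU s1) //; apply: arrow_hom_eq => //=.
by rewrite compA (ah_sq k) -compA s'E.
Qed.

(** Morphisms from [T] to the codomain of an arrow [a] correspond to morphisms
    from the arrow [0 -> T] to [a]. *)
Lemma arrow_kernel_cod (x a b : arrow) (k : hom x a) (p : hom a b) :
  is_kernel AZ k p -> is_kernel Z0 (ah_cod k) (ah_cod p).
Proof.
move=> [k0 ker]; split.
  exact: (f_equal (@ah_cod _ _ _) k0).
move=> T t t0.
have from0 (y : arrow) (q : hom T (arr_cod y)) :
    q ∘ from_zero Z0 T = arr y ∘ from_zero Z0 (arr_dom y).
  exact: from_zero_uniq.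
pose t' : @hom arrow (ArrowOb (from_zero Z0 T)) a :=
  @ArrowHom _ (ArrowOb (from_zero Z0 T)) a _ _ (from0 a t).
have /ker[s [sE sU]] : p ∘ t' = zero_mor AZ _ _.
  by apply: arrow_hom_eq => //=; apply: from_zero_uniq.
exists (ah_cod s); split; first exact: (f_equal (@ah_cod _ _ _) sE).
move=> s' s'E.
pose s1 : @hom arrow (ArrowOb (from_zero Z0 T)) x :=
  @ArrowHom _ (ArrowOb (from_zero Z0 T)) x _ _ (from0 x s').
rewrite (sU s1) //; apply: arrow_hom_eq => //=.
exact: from_zero_uniq.
Qed.

Lemma arrow_kernel (x a b : arrow) (k : hom x a) (p : hom a b) :
  is_kernel Z0 (ah_dom k) (ah_dom p) -> is_kernel Z0 (ah_cod k) (ah_cod p) ->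
  is_kernel AZ k p.
Proof.
move=> k0 k1; split.
  by apply: arrow_hom_eq; [case: k0 | case: k1].
move=> T t tE.
have [s0 [s0E s0U]] := proj2 k0 _ (ah_dom t) (f_equal (@ah_dom _ _ _) tE).
have [s1 [s1E s1U]] := proj2 k1 _ (ah_cod t) (f_equal (@ah_cod _ _ _) tE).
have sq : s1 ∘ arr T = arr x ∘ s0.
  apply: (kernel_monic k1).
  by rewrite !compA s1E (ah_sq k) -compA s0E (ah_sq t).
exists (ArrowHom sq : hom T x); split; first exact: arrow_hom_eq.
move=> s' s'E; apply: arrow_hom_eq => /=.
  by apply: s0U; rewrite -s'E.
by apply: s1U; rewrite -s'E.
Qed.

Definition splext_dom (b x : arrow) (e : splext AZ b x) :
    splext Z0 (arr_dom b) (arr_dom x) :=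
  SplExtension (f_equal (@ah_dom _ _ _) (se_split e))
    (arrow_kernel_dom (se_kernel e)).

Definition splext_cod (b x : arrow) (e : splext AZ b x) :
    splext Z0 (arr_cod b) (arr_cod x) :=
  SplExtension (f_equal (@ah_cod _ _ _) (se_split e))
    (arrow_kernel_cod (se_kernel e)).

Lemma splext_dom_cod (b x : arrow) (e : splext AZ b x) :
  mor_over (arr x) (arr b) (splext_dom e) (splext_cod e).
Proof.
exists (arr (se_ob e)); split; [|split] => /=; symmetry.
- exact: (ah_sq (se_ker e)).
- exact: (ah_sq (se_sec e)).
- exact: (ah_sq (se_epi e)).
Qed.

Lemma splext_arrow (B X B' X' : C) (u : hom X X') (w : hom B B')
    (e : splext Z0 B X) (e' : splext Z0 B' X') :
  mor_over u w e e' ->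
  exists E : splext AZ (ArrowOb w) (ArrowOb u),
    splext_dom E = e /\ splext_cod E = e'.
Proof.
case: e e' => [A k p s ps ke] [A' k' p' s' ps' ke'] [/= v [vk [vs ve]]] /=.
pose K := @ArrowHom _ (ArrowOb u) (ArrowOb v) k k' (eq_sym vk).
pose P := @ArrowHom _ (ArrowOb v) (ArrowOb w) p p' (eq_sym ve).
pose S := @ArrowHom _ (ArrowOb w) (ArrowOb v) s s' (eq_sym vs).
have PS : (P : @hom arrow _ _) ∘ S = idm _ by apply: arrow_hom_eq.
exists (SplExtension PS (@arrow_kernel _ _ _ K P ke ke')).
by split; congr SplExtension; apply: proof_irrelevance.
Qed.

Lemma arrow_splext_mor_dom (b x b' x' : arrow) (e : splext AZ b x)
    (e' : splext AZ b' x') (u : hom x x') (v : hom (se_ob e) (se_ob e'))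
    (w : hom b b') :
  is_splext_mor u v w ->
  @is_splext_mor _ _ _ _ _ _ (splext_dom e) (splext_dom e')
    (ah_dom u) (ah_dom v) (ah_dom w).
Proof.
move=> [k [s p]]; split; [|split].
- exact: (f_equal (@ah_dom _ _ _) k).
- exact: (f_equal (@ah_dom _ _ _) s).
- exact: (f_equal (@ah_dom _ _ _) p).
Qed.

Lemma arrow_splext_mor_cod (b x b' x' : arrow) (e : splext AZ b x)
    (e' : splext AZ b' x') (u : hom x x') (v : hom (se_ob e) (se_ob e'))
    (w : hom b b') :
  is_splext_mor u v w ->
  @is_splext_mor _ _ _ _ _ _ (splext_cod e) (splext_cod e')
    (ah_cod u) (ah_cod v) (ah_cod w).
Proof.
move=> [k [s p]]; split; [|split].
- exact: (f_equal (@ah_cod _ _ _) k).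
- exact: (f_equal (@ah_cod _ _ _) s).
- exact: (f_equal (@ah_cod _ _ _) p).
Qed.

Definition has_generic (X : C) : Prop :=
  exists (r : C) (g : splext Z0 r X),
    forall (B : C) (e : splext Z0 B X),
      exists! w : hom B r, mor_over (idm X) w e g.

Definition has_generic_arrow (X Z : C) (f : hom X Z) : Prop :=
  exists (r : C) (g0 : splext Z0 r X) (g1 : splext Z0 r Z),
    mor_over f (idm r) g0 g1 /\
    forall (B : C) (e0 : splext Z0 B X) (e1 : splext Z0 B Z),
      mor_over f (idm B) e0 e1 ->
      exists! w : hom B r,
        mor_over (idm X) w e0 g0 /\ mor_over (idm Z) w e1 g1.

Variable L : finitely_complete C.
Hypothesis proto : protomodular Z0.

Lemma arrow_protomodular : protomodular AZ.
Proof.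
move=> B X B' X' e e' u v w m /is_iso_arrowP[u0 u1] /is_iso_arrowP[w0 w1].
apply/is_iso_arrowP; split.
- exact: proto (arrow_splext_mor_dom m) u0 w0.
- exact: proto (arrow_splext_mor_cod m) u1 w1.
Qed.

(** The two components of a morphism form a commutative square automatically,
    because both ways around it are morphisms of split extensions over the same
    maps.  This is what lets domains and codomains be treated separately. *)
Lemma arrow_mor_overP (b x b' x' : arrow) (u : hom x x') (w : hom b b')
    (e : splext AZ b x) (e' : splext AZ b' x') :
  mor_over u w e e' <->
  mor_over (ah_dom u) (ah_dom w) (splext_dom e) (splext_dom e') /\
  mor_over (ah_cod u) (ah_cod w) (splext_cod e) (splext_cod e').
Proof.
split=> [[v m] | [[v0 m0] [v1 m1]]].
  split; [exists (ah_dom v) | exists (ah_cod v)].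
    exact: arrow_splext_mor_dom.
  exact: arrow_splext_mor_cod.
case: (m0) (m1) => [k0 [s0 p0]] [k1 [s1 p1]].
have sq : v1 ∘ arr (se_ob e) = arr (se_ob e') ∘ v0.
  apply: (splext_jointly_epic L proto (e := splext_dom e)).
  - rewrite -!compA k0 /= -(ah_sq (se_ker e)) [RHS]compA -(ah_sq (se_ker e')).
    by rewrite -compA -(ah_sq u) !compA k1.
  - rewrite -!compA s0 /= -(ah_sq (se_sec e)) [RHS]compA -(ah_sq (se_sec e')).
    by rewrite -compA -(ah_sq w) !compA s1.
by exists (ArrowHom sq); split; [|split]; apply: arrow_hom_eq.
Qed.

Lemma representable_arrow_generic (X Z : C) (f : hom X Z) :
  representable
    (presheaf_comp (SplExt AZ (arrow_finitely_complete L) (ArrowOb f))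
      (arrow_diag C)) <->
  has_generic_arrow f.
Proof.
apply: (iff_trans (representable_generic _ arrow_protomodular _ _)).
have overP (r B : C) (g : splext AZ (arrow_diag C r) (ArrowOb f))
    (e : splext AZ (arrow_diag C B) (ArrowOb f)) (w : hom B r) :
    mor_over (idm _) (fmap (arrow_diag C) w) e g <->
    mor_over (idm X) w (splext_dom e) (splext_dom g) /\
    mor_over (idm Z) w (splext_cod e) (splext_cod g).
  exact: (arrow_mor_overP (idm (ArrowOb f : arrow)) (fmap (arrow_diag C) w)).
split=> [[r [g gen]] | [r [g0 [g1 [g01 gen]]]]].
- exists r, (splext_dom g), (splext_cod g).
  split; first exact: (splext_dom_cod g).
  move=> B e0 e1 /splext_arrow[e [<- <-]].
  have [w [we wU]] := gen B e; exists w; split; first exact (proj1 (overP _ _ _ _ _) we).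
  by move=> w' /(proj2 (overP _ _ _ _ _)); apply: wU.
- have [g [E0 E1]] := splext_arrow g01; subst g0 g1.
  exists r, g => B e.
  have [w [we wU]] := gen B _ _ (splext_dom_cod e); exists w; split.
    exact (proj2 (overP _ _ _ _ _) we).
  by move=> w' w'e; apply: wU; apply (proj1 (overP _ _ _ _ _)).
Qed.

Lemma action_representable_generic :
  action_representable Z0 L <->
  forall X : C, has_generic X.
Proof.
(* The presheaf is its own composite with the identity functor, up to
   conversion. *)
pose I : functor C C := @Functor C C (fun x => x) (fun _ _ w => w)
  (fun _ => eq_refl) (fun _ _ _ _ _ => eq_refl).
split=> H X.
  exact: (proj1 (representable_generic L proto I X) (H X)).
exact: (proj2 (representable_generic L proto I X) (H X)).
Qed.

End ArrowSplitExtensions.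

(** * Normalizing data *)

Section Normalizers.
Variables (C : category) (Z0 : zero_object C) (L : finitely_complete C).
Hypothesis proto : protomodular Z0.

Section NormalizingData.
Variables (X' X : C) (f : hom X' X).

(** The pullback condition on normalizing data says that the zero class of the
    relation is [X']; equivalently, that [X'] is the kernel of the first
    projection, which turns the relation into a split extension. *)
Lemma normalizing_kernel (d : normalizing_data Z0 L f) :
  is_kernel Z0 (nd_ker d) (nd_r1 d) /\ nd_r2 d ∘ nd_ker d = nd_n d.
Proof.
have [sq pb] := nd_pullback d.
move: (f_equal (fun x => prod_fst L _ _ ∘ x) sq)
      (f_equal (fun x => prod_snd L _ _ ∘ x) sq).
rewrite !compA !prod_fstK !prod_sndK comp_idl zero_mor_compr => r1k r2k.
split=> //; split=> // T t t0.
have [] := pb T t (nd_r2 d ∘ t).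
  apply: prod_ext; rewrite !compA ?prod_fstK ?prod_sndK ?comp_idl //.
  by rewrite t0 !zero_mor_compr.
move=> s [[sE _] sU]; exists s; split=> // s' s'E; apply: sU.
by split=> //; rewrite -r2k -compA s'E.
Qed.

Lemma kernel_normalizing_pullback (N R : C) (n : hom X' N) (r1 r2 : hom R N)
    (k : hom X' R) :
  is_kernel Z0 k r1 -> r2 ∘ k = n ->
  is_pullback k n (prod_pair L r1 r2)
    (prod_pair L (zero_mor Z0 N N) (idm N)).
Proof.
move=> kerk r2k; split.
  apply: prod_ext; rewrite !compA ?prod_fstK ?prod_sndK ?comp_idl //.
  by rewrite zero_mor_compr (kernel_zero kerk).
move=> T a b ab.
move: (f_equal (fun x => prod_fst L _ _ ∘ x) ab)
      (f_equal (fun x => prod_snd L _ _ ∘ x) ab).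
rewrite !compA !prod_fstK !prod_sndK comp_idl zero_mor_compr => r1a r2a.
have [s [sE sU]] := proj2 kerk T a r1a.
exists s; split; first by rewrite -r2k -compA sE.
by move=> s' [s'E _]; apply: sU.
Qed.

Definition reflexive_normalizing_data (N : C) (e : splext Z0 N X')
    (r : hom (se_ob e) N) (m : hom N X) (fac : m ∘ (r ∘ se_ker e) = f)
    (rm : monic (prod_pair L (se_epi e) r)) (rs : r ∘ se_sec e = idm N) :
    normalizing_data Z0 L f :=
  NormalizingData fac (reflexive_relation_equivalence proto rm rs)
    (kernel_normalizing_pullback (se_kernel e) eq_refl).

End NormalizingData.

(** The kernel pair of [e -> B] is the congruence of the normal subobject [X] of
    [e].  Its legs are taken in the order (second, first) so that the kernel of
    the leading one is the kernel of a pullback of [e]. *)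
Section KernelPair.
Variables (B X : C) (e : splext Z0 B X).
Let q := se_epi e.

Lemma kernel_pair_split :
  pb_snd L q q ∘ pb_pair L (eq_refl (q ∘ idm _)) = idm (se_ob e).
Proof. by rewrite pb_sndK. Qed.

Definition kernel_pair_splext : splext Z0 (se_ob e) X :=
  SplExtension kernel_pair_split (splext_pb_kernel L q e).

Lemma kernel_pair_monic : monic (prod_pair L (pb_snd L q q) (pb_fst L q q)).
Proof.
move=> T a b ab; apply: pb_ext.
  by move: (f_equal (fun x => prod_snd L _ _ ∘ x) ab); rewrite !compA !prod_sndK.
by move: (f_equal (fun x => prod_fst L _ _ ∘ x) ab); rewrite !compA !prod_fstK.
Qed.

End KernelPair.

(** The universal property, restricted to the normalizing data in which the
    relation is the kernel pair of a split extension.  The morphism between the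
    relations is unique once it exists, so only its existence is kept, and its
    compatibility with the kernels is automatic. *)
Lemma normalizer_universal (X' X B : C) (f : hom X' X)
    (d : normalizing_data Z0 L f) (e : splext Z0 B X')
    (g : hom (se_ob e) X) :
  is_normalizer d -> g ∘ se_ker e = f ->
  exists! h : hom (se_ob e) (nd_ob d),
    nd_m d ∘ h = g /\ h ∘ se_ker e = nd_n d /\
    factors_through (prod_pair L (nd_r1 d) (nd_r2 d))
      (prod_pair L (h ∘ pb_snd L (se_epi e) (se_epi e))
                   (h ∘ pb_fst L (se_epi e) (se_epi e))).
Proof.
move=> dU gk; pose q := se_epi e.
have fac : g ∘ (pb_fst L q q ∘ se_ker (kernel_pair_splext e)) = f.
  by rewrite /= pb_fstK.
have rs : pb_fst L q q ∘ se_sec (kernel_pair_splext e) = idm _.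
  by rewrite /= pb_fstK.
pose d' := @reflexive_normalizing_data _ _ f _ (kernel_pair_splext e)
  (pb_fst L q q) g fac (@kernel_pair_monic _ _ e) rs.
have mapE (h : hom (se_ob e) (nd_ob d)) (a b : hom (nd_rel d') (se_ob e)) :
    prod_map L h h ∘ prod_pair L a b = prod_pair L (h ∘ a) (h ∘ b).
  by apply: prod_ext; rewrite !compA ?prod_fstK ?prod_sndK -compA
    ?prod_fstK ?prod_sndK.
have [[h v] [[/= mh [hn [vk vr]]] hU]] := dU d'.
exists h; split.
  split=> //; split; first by rewrite -hn /= pb_fstK.
  by exists v; rewrite vr mapE.
move=> h' [mh' [hn' [v' vr']]].
suff: (h, v) = (h', v') by case.
apply: hU => /=; split=> //; split; first by rewrite pb_fstK.
split; last by rewrite vr' mapE.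
have [rm _] := nd_equiv d; have [rk r2k] := normalizing_kernel d.
apply: rm; rewrite compA vr'; apply: prod_ext; rewrite !compA.
  by rewrite !prod_fstK -compA pb_sndK zero_mor_compl (kernel_zero rk).
by rewrite !prod_sndK -compA pb_fstK r2k.
Qed.

Lemma equivalence_euclidean (N R : C) (r1 r2 : hom R N) :
  is_equivalence_relation L r1 r2 -> forall (T : C) (a b : hom T R),
  r1 ∘ a = r1 ∘ b ->
  factors_through (prod_pair L r1 r2) (prod_pair L (r2 ∘ a) (r2 ∘ b)).
Proof.
move=> [_ [_ [[s [s1 s2]] [t [t1 t2]]]]] T a b ab.
have E : r2 ∘ (s ∘ a) = r1 ∘ b by rewrite compA s2.
exists (t ∘ pb_pair L E); apply: prod_ext.
  rewrite !compA !prod_fstK t1 -compA pb_fstK compA s1 //.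
by rewrite !compA !prod_sndK t2 -compA pb_sndK.
Qed.

End Normalizers.

(** * Generic split extensions and normalizers *)

Section GenericActors.
Variables (C : category) (Z0 : zero_object C) (L : finitely_complete C).
Hypothesis proto : protomodular Z0.

(** [D] consists of the elements of [rX * rZ] whose image in [QX * QZ]
    lies in the normalizer of the graph of [f].  The relation of the normalizer,
    pulled back to [D], is a split extension with kernel [X]; composing its
    second leg with the two projections of [QX * QZ] maps it to [QX] over the
    identity of [X] and to [QZ] over [f]. *)
Lemma normalizers_generic_arrow (X Z : C) (f : hom X Z) :
  has_generic Z0 X -> has_generic Z0 Z -> admits_normalizers Z0 L ->
  has_generic_arrow Z0 f.
Proof.
move=> [rX [QX genX]] [rZ [QZ genZ]] norm.
pose W := prod_ob L (se_ob QX) (se_ob QZ).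
pose gam : hom X W := prod_pair L (se_ker QX) (se_ker QZ ∘ f).
have gamm : monic gam.
  move=> T a b /(f_equal (fun x => prod_fst L _ _ ∘ x)).
  by rewrite !compA !prod_fstK; apply: (kernel_monic (se_kernel QX)).
have [d dU] := norm _ _ gam gamm.
have [rk r2k] := normalizing_kernel d.
have [rm [[s [s1 s2]] _]] := nd_equiv d.
pose S := SplExtension s1 rk.
pose sig : hom (prod_ob L rX rZ) W := prod_map L (se_sec QX) (se_sec QZ).
pose D := pb_ob L (nd_m d) sig.
pose t : hom D (nd_ob d) := pb_fst L (nd_m d) sig.
pose del : hom D (prod_ob L rX rZ) := pb_snd L (nd_m d) sig.
have mt : nd_m d ∘ t = sig ∘ del := pb_sq L _ _.
have r2_ext (B : C) (e : splext Z0 B X) (b : hom B D)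
    (v : hom (se_ob e) (nd_rel d)) :
    @is_splext_mor _ _ _ _ _ _ e S (idm X) v (t ∘ b) ->
    nd_m d ∘ (nd_r2 d ∘ v) ∘ se_ker e = gam /\
    nd_m d ∘ (nd_r2 d ∘ v) ∘ se_sec e = sig ∘ (del ∘ b).
  move=> [/= vk [vs _]]; split.
    by rewrite -!compA vk comp_idr r2k nd_fac.
  by rewrite -!compA vs (compE _ s2) comp_idl !compA mt.
have toX (B : C) (e : splext Z0 B X) (b : hom B D) :
    mor_over (idm X) (t ∘ b) e S ->
    mor_over (idm X) (prod_fst L rX rZ ∘ del ∘ b) e QX.
  move=> [v /r2_ext[vk vs]].
  exists (prod_fst L _ _ ∘ (nd_m d ∘ (nd_r2 d ∘ v))).
  apply: (splext_morP L proto); rewrite -compA ?vk ?vs.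
    by rewrite prod_fstK comp_idr.
  by rewrite !compA prod_fstK.
have toZ (B : C) (e : splext Z0 B X) (b : hom B D) :
    mor_over (idm X) (t ∘ b) e S ->
    mor_over f (prod_snd L rX rZ ∘ del ∘ b) e QZ.
  move=> [v /r2_ext[vk vs]].
  exists (prod_snd L _ _ ∘ (nd_m d ∘ (nd_r2 d ∘ v))).
  apply: (splext_morP L proto); rewrite -compA ?vk ?vs.
    by rewrite prod_sndK.
  by rewrite !compA prod_sndK.
pose G0 := splext_pb L t S.
pose del2 := prod_snd L rX rZ ∘ del.
pose G1 := splext_pb L del2 QZ.
have G0S : mor_over (idm X) t G0 S := mor_over_pb L t S.
have G1Z : mor_over (idm Z) del2 G1 QZ := mor_over_pb L del2 QZ.
have G01 : mor_over f (idm D) G0 G1.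
  apply: (mor_over_lift L proto G1Z); apply: toZ.
  by rewrite comp_idr.
exists D, G0, G1; split=> // B e0 e1 e01.
have [b1 [eX b1U]] := genX B e0; have [b2 [eZ b2U]] := genZ B e1.
have eXZ : mor_over f b2 e0 QZ.
  by move: (mor_over_comp eZ e01); rewrite comp_idl comp_idr.
case: (eX) (eXZ) => [v1 [k1 [z1 _]]] [v2 [k2 [z2 _]]].
pose g : hom (se_ob e0) W := prod_pair L v1 v2.
have gk : g ∘ se_ker e0 = gam.
  apply: prod_ext; rewrite !compA ?prod_fstK ?prod_sndK //.
  by rewrite k1 comp_idr.
have gs : g ∘ se_sec e0 = sig ∘ prod_pair L b1 b2.
  apply: prod_ext; rewrite !compA ?prod_fstK ?prod_sndK.
    by rewrite z1 -compA prod_fstK.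
  by rewrite z2 -compA prod_sndK.
have [h [[mh [hn [v vr]]] hU]] := normalizer_universal proto dU gk.
move: (f_equal (fun x => prod_fst L _ _ ∘ x) vr)
      (f_equal (fun x => prod_snd L _ _ ∘ x) vr).
rewrite !compA !prod_fstK !prod_sndK => vr1 vr2.
have E : nd_m d ∘ (h ∘ se_sec e0) = sig ∘ prod_pair L b1 b2.
  by rewrite compA mh.
pose b := pb_pair L E.
have tb : t ∘ b = h ∘ se_sec e0 by rewrite /t pb_fstK.
have db : del ∘ b = prod_pair L b1 b2 by rewrite /del pb_sndK.
exists b; split.
  split.
    (* Pairing an element [x] of [e0] with the element of the section below it
       gives a pair in the kernel pair, which [v] sends to the relation. *)
    apply: (mor_over_lift L proto G0S).
    have E' : se_epi e0 ∘ idm _ = se_epi e0 ∘ (se_sec e0 ∘ se_epi e0).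
      by rewrite compA se_split comp_idl comp_idr.
    exists (v ∘ pb_pair L E'); apply: (splext_morP L proto); apply: rm;
      rewrite !compA; apply: prod_ext;
      rewrite !compA ?prod_fstK ?prod_sndK ?vr1 ?vr2 /=.
    + rewrite -!compA (compE _ (pb_sndK L E')) -compA.
      rewrite (kernel_zero (se_kernel e0)) comp_idr !zero_mor_compl.
      by rewrite (kernel_zero rk).
    + by rewrite -!compA (compE _ (pb_fstK L E')) comp_idl comp_idr r2k.
    + rewrite -!compA (compE _ (pb_sndK L E')) -compA se_split comp_idr.
      by rewrite (compE _ s1) comp_idl tb.
    + rewrite -!compA (compE _ (pb_fstK L E')) comp_idl.
      by rewrite (compE _ s2) comp_idl tb.
  apply: (mor_over_lift L proto G1Z).
  by rewrite /del2 -compA db prod_sndK.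
move=> b' [b'0 b'1].
have b'S : mor_over (idm X) (t ∘ b') e0 S.
  by move: (mor_over_comp G0S b'0); rewrite comp_idl.
have db' : del ∘ b' = prod_pair L b1 b2.
  apply: prod_ext; rewrite ?prod_fstK ?prod_sndK compA; symmetry.
    by apply: b1U; apply: toX.
  by apply: b2U; rewrite -(comp_idl (idm Z)); apply: (mor_over_comp G1Z).
(* Any classifying map yields, by the second leg of the relation, another
   factorization of [g] through the normalizer. *)
apply: pb_ext; rewrite -/t -/del ?db ?db' // tb.
case: b'S => v' m'; have [mk ms] := r2_ext _ _ _ _ m'.
have [k' [z' q']] := m'; rewrite /= in k' z' q'.
rewrite (hU (nd_r2 d ∘ v')); last first.
  by rewrite -compA z' (compE _ s2) comp_idl.
split.
  apply: (splext_jointly_epic L proto); rewrite ?mk ?ms ?gk ?gs //.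
  by rewrite db'.
split; first by rewrite -compA k' comp_idr r2k.
rewrite -!compA; apply: (equivalence_euclidean (nd_equiv d)).
by rewrite !compA -q' -!compA pb_sq.
Qed.

(** Up to isomorphism each [B] has just one split extension with kernel [0], and
    every morphism required to or from it exists. *)
Lemma zero_arrow_generic (X : C) :
  has_generic_arrow Z0 (to_zero Z0 X) -> has_generic Z0 X.
Proof.
move=> [r [g0 [g1 [_ gen]]]]; exists r, g0.
have triv (B : C) : exists e : splext Z0 B (zero Z0),
    (forall e0 : splext Z0 B X, mor_over (to_zero Z0 X) (idm B) e0 e) /\
    forall w : hom B r, mor_over (idm (zero Z0)) w e g1.
  have ker : is_kernel Z0 (from_zero Z0 B) (idm B).
    split; first exact: from_zero_uniq.
    move=> T t; rewrite comp_idl => ->; exists (to_zero Z0 T); split=> // s _.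
    exact: to_zero_uniq.
  exists (SplExtension (comp_idl (idm B)) ker); split=> [e0 | w].
    exists (se_epi e0); apply: (splext_morP L proto) => /=.
      exact: (kernel_zero (se_kernel e0)).
    by rewrite se_split comp_idl.
  exists (se_sec g1 ∘ w); apply: (splext_morP L proto) => /=.
    exact: from_zero_uniq.
  by rewrite comp_idr.
move=> B e0; have [e1 [e01 e1g]] := triv B.
have [w [[we _] wU]] := gen B e0 e1 (e01 e0).
by exists w; split=> // w' w'e; apply: wU.
Qed.

Lemma conj_kernel (X : C) :
  is_kernel Z0 (prod_pair L (zero_mor Z0 X X) (idm X)) (prod_fst L X X).
Proof.
split; first by rewrite prod_fstK.
move=> T t t0; exists (prod_snd L X X ∘ t); split=> [|s <-].
  apply: prod_ext; rewrite !compA ?prod_fstK ?prod_sndK ?comp_idl //.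
  by rewrite t0 !zero_mor_compr.
by rewrite compA prod_sndK comp_idl.
Qed.

(** The action of [X] on itself by conjugation: in groups, [(a, b)] in [X * X]
    corresponds to [(b a^-1, a)] in the semidirect product. *)
Definition conj_splext (X : C) : splext Z0 X X :=
  SplExtension (prod_fstK L (idm X) (idm X)) (conj_kernel X).

(** The first component of a morphism to [conj_splext X] over [a] is forced to be
    [a] composed with the projection to the base; the second is [g]. *)
Lemma mor_over_conjP (B X' X : C) (f : hom X' X) (a : hom B X)
    (e : splext Z0 B X') :
  mor_over f a e (conj_splext X) <->
  exists g : hom (se_ob e) X, g ∘ se_ker e = f /\ g ∘ se_sec e = a.
Proof.
split=> [[v [vk [vs _]]] | [g [gk gs]]].
  exists (prod_snd L X X ∘ v); rewrite -!compA vk vs /= !compA !prod_sndK.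
  by rewrite !comp_idl.
exists (prod_pair L (a ∘ se_epi e) g).
apply: (splext_morP L proto) => /=; apply: prod_ext;
  rewrite !compA ?prod_fstK ?prod_sndK ?comp_idl //.
  by rewrite -compA (kernel_zero (se_kernel e)) zero_mor_compl zero_mor_compr.
by rewrite -compA se_split comp_idr.
Qed.

(** [N] is the object of the pairs, of an element of [X] and an element of the
    base of the generic pair of [f], that induce the same action on [X].  For
    [m] to be monic the first must determine the second.  Given [t1] and [t2]
    into [N] with [m t1 = m t2], the two split extensions with kernel [X'] that
    they classify are subobjects of one split extension [F] with kernel [X], so
    they agree, and the generic pair classifies them by the same map. *)
Lemma normalizer_action (X' X : C) (f : hom X' X) :
  monic f -> has_generic Z0 X -> has_generic_arrow Z0 f ->
  exists (N : C) (m : hom N X) (S : splext Z0 N X'),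
    monic m /\ mor_over f m S (conj_splext X) /\
    forall (T : C) (a : hom T X) (e : splext Z0 T X'),
      mor_over f a e (conj_splext X) ->
      exists b : hom T N, m ∘ b = a /\ mor_over (idm X') b e S.
Proof.
move=> fm [r [Q genQ]] [D [P' [P [PP genP]]]].
have [c [cQ _]] := genQ X (conj_splext X).
have [w [wQ _]] := genQ D P.
pose m := pb_fst L c w; pose p := pb_snd L c w.
have mp : c ∘ m = w ∘ p := pb_sq L c w.
pose S := splext_pb L p P'.
have SP : mor_over (idm X') p S P' := mor_over_pb L p P'.
have fw : mor_over f w P' Q.
  by move: (mor_over_comp wQ PP); rewrite comp_idl comp_idr.
have SX : mor_over f m S (conj_splext X).
  apply: (mor_over_lift L proto cQ); rewrite mp.
  by move: (mor_over_comp fw SP); rewrite comp_idr.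
exists (pb_ob L c w), m, S; split; last split=> //.
- move=> T t1 t2 t12; apply: pb_ext => //; rewrite -/p.
  pose F := splext_pb L (m ∘ t1) (conj_splext X).
  pose E1 := splext_pb L t1 S; pose E2 := splext_pb L t2 S.
  have FX : mor_over (idm X) (m ∘ t1) F (conj_splext X) := mor_over_pb L _ _.
  have E1S : mor_over (idm X') t1 E1 S := mor_over_pb L _ _.
  have E2S : mor_over (idm X') t2 E2 S := mor_over_pb L _ _.
  have EF (t : hom T (pb_ob L c w)) (E : splext Z0 T X') :
      m ∘ t1 = m ∘ t -> mor_over (idm X') t E S -> mor_over f (idm T) E F.
    move=> tE ES; apply: (mor_over_lift L proto FX).
    by rewrite comp_idr tE -(comp_idr f); apply: (mor_over_comp SX).
  have E12 := subextension_uniq L proto fm (EF _ _ eq_refl E1S) (EF _ _ t12 E2S).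
  have [b [_ bU]] := genP T E1 F (EF _ _ eq_refl E1S).
  have FP (t : hom T (pb_ob L c w)) :
      m ∘ t1 = m ∘ t -> mor_over (idm X) (p ∘ t) F P.
    move=> tE; apply: (mor_over_lift L proto wQ).
    rewrite compA -mp -compA -tE -(comp_idl (idm X)).
    exact: (mor_over_comp cQ).
  have E1P := mor_over_comp SP E1S.
  have E2P := mor_over_comp SP (mor_over_comp E2S E12).
  rewrite !comp_idl in E1P E2P; rewrite comp_idr in E2P.
  by transitivity b; [symmetry|]; apply: bU; split=> //; apply: FP.
- move=> T a e eX; pose F := splext_pb L a (conj_splext X).
  have FX : mor_over (idm X) a F (conj_splext X) := mor_over_pb L _ _.
  have eF : mor_over f (idm T) e F.
    by apply: (mor_over_lift L proto FX); rewrite comp_idr.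
  have [b [[eP FP] _]] := genP T e F eF.
  have [u [_ uU]] := genQ T F.
  have cw : c ∘ a = w ∘ b.
    transitivity u; [symmetry|]; apply: uU; rewrite -(comp_idl (idm X)).
      exact: (mor_over_comp cQ).
    exact: (mor_over_comp wQ).
  exists (pb_pair L cw); split; first exact: pb_fstK.
  by apply: (mor_over_lift L proto SP); rewrite pb_sndK.
Qed.

(** The subobject [X'] acts on itself by conjugation, hence lies in [N].  In
    groups [S] is the semidirect product of [X'] and [N], and [g : S -> X]
    multiplies the two factors in [X].  It lands in [N], because it does so on
    the kernel [X'] and on the section [N]; this gives the second leg [r] of the
    relation. *)
Lemma generic_normalizer (X' X : C) (f : hom X' X) :
  monic f -> has_generic Z0 X -> has_generic_arrow Z0 f ->
  exists d : normalizing_data Z0 L f, is_normalizer d.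
Proof.
move=> fm genX genf.
have [N [m [S [mm [SX lift]]]]] := normalizer_action fm genX genf.
have [n [mn _]] : exists n : hom X' N,
    m ∘ n = f /\ mor_over (idm X') n (conj_splext X') S.
  apply: lift; apply/mor_over_conjP; exists (f ∘ prod_snd L X' X').
  by rewrite -!compA !prod_sndK comp_idr.
have [g [gk gs]] := proj1 (mor_over_conjP _ _ _) SX.
have [||r mr] := @splext_factor _ _ L proto _ _ _ _ S m g mm.
- by exists n; rewrite gk.
- by exists (idm N); rewrite gs comp_idr.
have rk : r ∘ se_ker S = n by apply: mm; rewrite compA mr gk.
have rs : r ∘ se_sec S = idm N by apply: mm; rewrite compA mr gs comp_idr.
have fac : m ∘ (r ∘ se_ker S) = f by rewrite rk.
(* The two legs together form a morphism to [conj_splext N] over the monic [n]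
   and the identity of [N]. *)
have nm : monic n by move=> T a b ab; apply: fm; rewrite -mn -!compA ab.
have rm : monic (prod_pair L (se_epi S) r).
  have pm : @is_splext_mor _ _ _ _ _ _ S (conj_splext N) n
      (prod_pair L (se_epi S) r) (idm N).
    apply: (splext_morP L proto) => /=; apply: prod_ext;
      rewrite !compA ?prod_fstK ?prod_sndK ?comp_idl ?se_split //.
    by rewrite (kernel_zero (se_kernel S)) zero_mor_compr.
  by apply: (splext_mor_monic L proto pm nm) => T a b; rewrite !comp_idl.
exists (reflexive_normalizing_data proto fac rm rs) => d'.
have [rk' r2k'] := normalizing_kernel d'.
have [_ [[s' [s1' s2']] _]] := nd_equiv d'.
pose S' := SplExtension s1' rk'.
have [h [mh [v [vk [vs ve]]]]] : exists h : hom (nd_ob d') N,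
    m ∘ h = nd_m d' /\ mor_over (idm X') h S' S.
  apply: lift; apply/mor_over_conjP; exists (nd_m d' ∘ nd_r2 d').
  by rewrite -!compA /= r2k' s2' comp_idr nd_fac.
have rv : r ∘ v = h ∘ nd_r2 d'.
  apply: mm; apply: (splext_jointly_epic L proto (e := S')).
    rewrite -!compA vk comp_idr rk mn /= r2k' compA mh; exact: (eq_sym (nd_fac d')).
  by rewrite -!compA vs (compE _ rs) comp_idl /= s2' comp_idr.
exists (h, v); split=> /=.
  split=> //; split; first by apply: mm; rewrite compA mh nd_fac fac.
  split; first by rewrite -[LHS]/(v ∘ se_ker S') vk comp_idr.
  apply: prod_ext; rewrite !compA ?prod_fstK ?prod_sndK -?compA
    ?prod_fstK ?prod_sndK //.
move=> [h' v'] /= [mh' [_ [_ vE']]].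
have hE : h = h' by apply: mm; rewrite mh mh'.
subst h'; congr (_, _); apply: rm; rewrite vE'.
apply: prod_ext; rewrite !compA ?prod_fstK ?prod_sndK -?compA
  ?prod_fstK ?prod_sndK //.
Qed.

End GenericActors.

Unset Implicit Arguments.

Theorem theorem3p3 (C : category) (Z0 : zero_object C)
    (L : finitely_complete C) (proto : protomodular Z0) :
  (action_representable Z0 L /\ admits_normalizers Z0 L) <->
  (forall (X Z : C) (f : hom X Z),
     representable
       (presheaf_comp
          (SplExt (arrow_zero Z0) (arrow_finitely_complete L)
             (ArrowOb f))
          (arrow_diag C))).
Proof.
split=> [[/(action_representable_generic L proto) rep norm] X Z f | rep].
  apply/(representable_arrow_generic L proto).
  exact: (normalizers_generic_arrow proto f (rep X) (rep Z) norm).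
have gen X Z (f : hom X Z) : has_generic_arrow Z0 f.
  exact/(representable_arrow_generic L proto).
have genX X : has_generic Z0 X by apply: zero_arrow_generic (gen _ _ _).
split; first exact/(action_representable_generic L proto).
by move=> X' X f fm; apply: generic_normalizer.
Qed.
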